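(* For all $n,k\ge 1$, the set of permutations $w\in\mathcal{L}_{n,k}(12\cdots(k+2))$ such that $w^{-1}\in\mathcal{L}_{n,k}(12\cdots(k+2))$ is in bijection with $S_n(12\cdots(k+2))$.
   Context: A word $w$ contains a pattern $p\in S_m$ if some subsequence of $w$ of length $m$ is order-isomorphic to $p$; otherwise $w$ avoids $p$; $S(p)$ is the set of elements of $S$ avoiding $p$, and $S_n$ is the set of all permutations of $[n]$. For $n,k\ge 1$, $\mathcal{L}_{n,k}\subseteq S_{nk}$ is the set of permutations $w=w_{1,1}\cdots w_{1,k}w_{2,1}\cdots w_{n,k}$ such that (L1) $w_{i,j}<w_{i,j+1}$ for $1\le i\le n$, $1\le j\le k-1$, and (L2) $w_{i,j+1}>w_{i+1,j}$ for $1\le i\le n-1$, $1\le j\le k-1$. *)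

(* Defs.v *)
From mathcomp Require Import all_boot all_fingroup.

Set Implicit Arguments.
Unset Strict Implicit.
Unset Printing Implicit Defensive.

(* A permutation of [N] is an element of 'S_N, read as
   the word w 0, w 1, ..., w (N - 1); positions and values start at 0. *)

Definition contains (N m : nat) (w : 'S_N) (p : 'S_m) : bool :=
  [exists f : {ffun 'I_m -> 'I_N},
     [forall a : 'I_m, forall b : 'I_m, (a < b) ==> (f a < f b)] &&
     [forall a : 'I_m, forall b : 'I_m,
        (w (f a) < w (f b)) == (p a < p b)]].

Definition avoiders (N m : nat) (S : {set 'S_N}) (p : 'S_m) : {set 'S_N} :=
  [set w in S | ~~ contains w p].

(* The pattern 12...m. *)
Definition incr_pattern (m : nat) : 'S_m := 1%g.

Lemma pos_proof (n k : nat) (i : 'I_n) (j : 'I_k) : i * k + j < n * k.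
Proof.
by apply: leq_trans (leq_mul (ltn_ord i) (leqnn k)); rewrite mulSn addnC ltn_add2r.
Qed.

(* The position of w_{i,j} in the word w_{1,1} ... w_{1,k} w_{2,1} ... w_{n,k}. *)
Definition pos (n k : nat) (i : 'I_n) (j : 'I_k) : 'I_(n * k) :=
  Ordinal (pos_proof i j).

(* Conditions (L1) and (L2); j' and i' stand for j + 1 and i + 1, and their
   types restrict j and i to the ranges in which these indices exist. *)
Definition Lset (n k : nat) : {set 'S_(n * k)} :=
  [set w : 'S_(n * k) |
     [forall i : 'I_n, forall j : 'I_k, forall j' : 'I_k,
        (j' == j.+1 :> nat) ==> (w (pos i j) < w (pos i j'))] &&
     [forall i : 'I_n, forall i' : 'I_n, forall j : 'I_k, forall j' : 'I_k,
        (i' == i.+1 :> nat) && (j' == j.+1 :> nat) ==>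
        (w (pos i j') > w (pos i' j))]].

Definition in_bijection (T U : finType) (A : {set T}) (B : {set U}) : Prop :=
  exists f : {x : T | x \in A} -> {y : U | y \in B}, bijective f.

(* Main.v *)
Require Import Defs.
From mathcomp Require Import all_boot all_fingroup zify.

Set Implicit Arguments.
Unset Strict Implicit.
Unset Printing Implicit Defensive.

(* Given avoidance of 12...(k+2), condition (L2) is automatic, so the words [w]
   in question are those for which [w] and [w^-1] increase on each block of
   length k.  Such a word is determined by the n x n matrix counting the
   positions of block i whose values lie in block j; all row and column sums
   are k, and the longest increasing subsequences of the word are the heaviest
   weakly increasing chains of cells.  RSK sends these matrices to the pairs of
   Gelfand-Tsetlin patterns (i-th row = partition with at most i parts) with a
   common last row, weights (k,...,k) and entries at most K = k + 1.
   Complementing every i-th row in the rectangle with i rows of length K turns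
   the weights into K - k = 1, i.e. turns the matrices into permutation
   matrices.  RSK is used in the form of Fomin's growth diagrams, whose local
   rule determines the diagram from the matrix and from the final boundary, and
   whose first parts obey the recursion for the heaviest chains. *)

(** * Growth diagrams *)

(** Each entry is computed from the corner, the entry above and the entry to the left. This serves
    twice: with [fwd] from the zero boundary, and with [bwd] and both indices reversed from the
    final boundary. The entry at (0, 0) is [top 0]. *)
Fixpoint grid (T : Type) (f : nat -> nat -> T -> T -> T -> T)
    (top left : nat -> T) (i : nat) : nat -> T :=
  if i is i'.+1 then
    fix row j := if j is j'.+1
      then f i' j' (grid f top left i' j') (grid f top left i' j'.+1) (row j')
      else left i
  else top.

(** Induction row by row: the edges along row i and the leftmost vertical edge yield all vertical
    edges below row i, hence the edges along row i + 1. *)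
Lemma grid_edges (T : Type) (E : T -> T -> Prop) (n : nat) (g : nat -> nat -> T) :
  (forall j, j < n -> E (g 0 j) (g 0 j.+1)) ->
  (forall i, i < n -> E (g i 0) (g i.+1 0)) ->
  (forall i j, i < n -> j < n ->
     E (g i j) (g i j.+1) -> E (g i j) (g i.+1 j) ->
     E (g i j.+1) (g i.+1 j.+1) /\ E (g i.+1 j) (g i.+1 j.+1)) ->
  (forall i j, i < n -> j <= n -> E (g i j) (g i.+1 j)) /\
  (forall i j, i <= n -> j < n -> E (g i j) (g i j.+1)).
Proof.
move=> Htop Hleft Hstep.
have Hcol i : i < n -> (forall j, j < n -> E (g i j) (g i j.+1)) ->
    forall j, j <= n -> E (g i j) (g i.+1 j).
  move=> lin Hi; elim=> [|j IHj] ljn; first exact: Hleft.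
  by have [] := Hstep i j lin ljn (Hi j ljn) (IHj (ltnW ljn)).
have Hrow i : i <= n -> forall j, j < n -> E (g i j) (g i j.+1).
  elim: i => [|i IHi] lin j ljn; first exact: Htop.
  have Hi := IHi (ltnW lin).
  by have [] := Hstep i j lin ljn (Hi j ljn) (Hcol i lin Hi j (ltnW ljn)).
split=> i j lin ljn; last exact: Hrow.
by apply: Hcol => //; apply: Hrow; apply: ltnW.
Qed.

(* [nu / mu] is a horizontal strip. *)
Definition hstrip (mu nu : nat -> nat) : Prop :=
  forall t, (mu t <= nu t) && (nu t.+1 <= mu t).

(* Fomin's local rule for RSK on matrices, with the subtraction moved to the
   other side: [mu] sits at the corner (i, j), [nu1] and [nu2] at its two
   neighbours, [lam] at (i + 1, j + 1), and [a] is the entry of the cell. *)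
Definition local_rule (a : nat) (mu nu1 nu2 lam : nat -> nat) : Prop :=
  lam 0 = maxn (nu1 0) (nu2 0) + a /\
  forall t, lam t.+1 + mu t =
            maxn (nu1 t.+1) (nu2 t.+1) + minn (nu1 t) (nu2 t).

(** [fwd] solves the local rule for [lam], and [bwd] below solves it for [mu]. The truncated
    subtractions are exact when the given edges are horizontal strips. *)
Definition fwd (a : nat) (mu nu1 nu2 : nat -> nat) (t : nat) : nat :=
  if t is s.+1
  then maxn (nu1 t) (nu2 t) + minn (nu1 s) (nu2 s) - mu s
  else maxn (nu1 0) (nu2 0) + a.

Definition bwd (lam nu1 nu2 : nat -> nat) (t : nat) : nat :=
  maxn (nu1 t.+1) (nu2 t.+1) + minn (nu1 t) (nu2 t) - lam t.+1.

Lemma local_rule_fwd a mu nu1 nu2 :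
  hstrip mu nu1 -> hstrip mu nu2 -> local_rule a mu nu1 nu2 (fwd a mu nu1 nu2).
Proof.
by move=> H1 H2; split=> // t; have := H1 t; have := H2 t => /=; lia.
Qed.

Lemma local_rule_bwd nu1 nu2 lam :
  hstrip nu1 lam -> hstrip nu2 lam ->
  local_rule (lam 0 - maxn (nu1 0) (nu2 0)) (bwd lam nu1 nu2) nu1 nu2 lam.
Proof.
move=> H1 H2; split=> [|t]; first by have := H1 0; have := H2 0; lia.
by have := H1 t; have := H2 t; have := H1 t.+1; have := H2 t.+1;
  rewrite /bwd; lia.
Qed.

(** The strips place [mu t] in the interval from [maxn (nu1 t.+1) (nu2 t.+1)] to
    [minn (nu1 t) (nu2 t)]. The rule reflects it in this interval, so [lam t.+1] lies there too,
    which is what the new strips ask. The converse direction is the same reflection. *)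
Lemma local_rule_hstrip_up a mu nu1 nu2 lam :
  local_rule a mu nu1 nu2 lam -> hstrip mu nu1 -> hstrip mu nu2 ->
  hstrip nu1 lam /\ hstrip nu2 lam.
Proof.
move=> [Ha Hl] H1 H2; split=> -[|t].
- by have := Hl 0; have := H1 0; have := H2 0; lia.
- by have := Hl t; have := Hl t.+1; have := H1 t; have := H2 t;
    have := H1 t.+1; have := H2 t.+1; lia.
- by have := Hl 0; have := H1 0; have := H2 0; lia.
- by have := Hl t; have := Hl t.+1; have := H1 t; have := H2 t;
    have := H1 t.+1; have := H2 t.+1; lia.
Qed.

Lemma local_rule_hstrip_down a mu nu1 nu2 lam :
  local_rule a mu nu1 nu2 lam -> hstrip nu1 lam -> hstrip nu2 lam ->
  hstrip mu nu1 /\ hstrip mu nu2.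
Proof.
move=> [_ Hl] H1 H2; split=> t;
by have := Hl t; have := H1 t; have := H2 t; have := H1 t.+1;
  have := H2 t.+1; lia.
Qed.

Definition growth (n : nat) (A : nat -> nat -> nat)
    (lam : nat -> nat -> nat -> nat) : Prop :=
  [/\ forall j t, j <= n -> lam 0 j t = 0,
      forall i t, i <= n -> lam i 0 t = 0 &
      forall i j, i < n -> j < n ->
        local_rule (A i j) (lam i j) (lam i j.+1) (lam i.+1 j) (lam i.+1 j.+1)].

Lemma local_rule_sym a mu nu1 nu2 lam :
  local_rule a mu nu1 nu2 lam -> local_rule a mu nu2 nu1 lam.
Proof.
by move=> [Ha Hl]; split=> [|t]; rewrite ?Hl ?Ha; rewrite maxnC // minnC.
Qed.

Lemma growth_trans n A lam :
  growth n A lam -> growth n (fun i j => A j i) (fun i j => lam j i).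
Proof.
by case=> H0 H1 Hl; split=> // i j lin ljn; apply/local_rule_sym/Hl.
Qed.

Lemma growth_hstrip n A lam : growth n A lam ->
  (forall i j, i < n -> j <= n -> hstrip (lam i j) (lam i.+1 j)) /\
  (forall i j, i <= n -> j < n -> hstrip (lam i j) (lam i j.+1)).
Proof.
case=> H0 H1 Hl; apply: grid_edges => [j ljn t|i lin t|i j lin ljn E1 E2].
- by rewrite !H0 // ltnW.
- by rewrite !H1 // ltnW.
exact: local_rule_hstrip_up (Hl i j lin ljn) E1 E2.
Qed.

Lemma growth_exists n A : exists lam, growth n A lam.
Proof.
pose z (_ t : nat) := 0.
pose lam := grid (fun i j => fwd (A i j)) z z.
have [E1 E2] : (forall i j, i < n -> j <= n -> hstrip (lam i j) (lam i.+1 j)) /\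
    (forall i j, i <= n -> j < n -> hstrip (lam i j) (lam i j.+1)).
  apply: grid_edges => [j _ t|[|i] _ t|i j lin ljn F1 F2] //.
  exact: local_rule_hstrip_up (local_rule_fwd _ F1 F2) F1 F2.
exists lam; split=> // [[|i] //|i j lin ljn].
by apply: local_rule_fwd; [apply: E2 => //; apply: ltnW|apply: E1 => //; apply: ltnW].
Qed.

Lemma growth_uniq n A lam lam' :
  growth n A lam -> growth n A lam' ->
  forall i j t, i <= n -> j <= n -> lam i j t = lam' i j t.
Proof.
case=> H0 H1 Hl [H0' H1' Hl'].
elim=> [|i IHi] j; first by move=> t _ ljn; rewrite H0 // H0'.
elim: j => [|j IHj] t lin ljn; first by rewrite H1 // H1'.
have [Ha Hr] := Hl i j lin ljn; have [Ha' Hr'] := Hl' i j lin ljn.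
have K1 s := IHi j.+1 s (ltnW lin) ljn.
have K2 s := IHj s lin (ltnW ljn).
have K3 s := IHi j s (ltnW lin) (ltnW ljn).
case: t => [|t]; first by rewrite Ha Ha' K1 K2.
by have := Hr t; have := Hr' t; rewrite !K1 !K2 !K3; lia.
Qed.

(** Solved for [mu], the rule recovers the diagram from its last row and column back to the origin;
    the first parts then give the matrix entries. *)
Lemma growth_uniq_matrix n A A' lam lam' :
  growth n A lam -> growth n A' lam' ->
  (forall i t, i <= n -> lam i n t = lam' i n t) ->
  (forall j t, j <= n -> lam n j t = lam' n j t) ->
  forall i j, i < n -> j < n -> A i j = A' i j.
Proof.
case=> _ _ Hl [_ _ Hl'] HP HQ.
have Heq x : forall y t, x <= n -> y <= n ->
    lam (n - x) (n - y) t = lam' (n - x) (n - y) t.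
  elim: x => [|x IHx] y; first by move=> t _ lyn; rewrite subn0 HQ // leq_subr.
  elim: y => [|y IHy] t lxn lyn; first by rewrite subn0 HP // leq_subr.
  have [Ex Ey] : n - x = (n - x.+1).+1 /\ n - y = (n - y.+1).+1 by lia.
  have lx : n - x.+1 < n by lia.
  have ly : n - y.+1 < n by lia.
  have [_ Hr] := Hl _ _ lx ly; have [_ Hr'] := Hl' _ _ lx ly.
  have K1 s := IHx y.+1 s (ltnW lxn) lyn.
  have K2 s := IHy s lxn (ltnW lyn).
  have K3 s := IHx y s (ltnW lxn) (ltnW lyn).
  rewrite Ex in K1 K3; rewrite Ey in K2 K3.
  by have := Hr t; have := Hr' t; rewrite !K1 !K2 !K3; lia.
have {}Heq i j t : i <= n -> j <= n -> lam i j t = lam' i j t.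
  by move=> lin ljn; have := Heq (n - i) (n - j) t (leq_subr _ _) (leq_subr _ _);
    rewrite !subKn.
move=> i j lin ljn; have [Ha _] := Hl i j lin ljn; have [Ha' _] := Hl' i j lin ljn.
by move: Ha Ha'; rewrite !Heq ?(ltnW lin) ?(ltnW ljn) //; lia.
Qed.

(* A chain of partitions whose i-th term has at most i parts, i.e. a
   Gelfand-Tsetlin pattern, encoding a semistandard tableau. *)
Definition GT (n : nat) (P : nat -> nat -> nat) : Prop :=
  (forall t, P 0 t = 0) /\ (forall i, i < n -> hstrip (P i) (P i.+1)).

Lemma growth_GT n A lam : growth n A lam -> GT n (fun i => lam i n).
Proof.
move=> G; have [H0 _ _] := G; split=> [t|i lin]; first exact: H0.
by have [E _] := growth_hstrip G; apply: E.
Qed.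

Lemma GT_mono n P : GT n P -> forall i t, i <= n -> P i t <= P n t.
Proof.
case=> _ H i t lin; rewrite -(subKn lin); move: (n - i) (leq_subr i n).
elim=> [|x IHx] lxn; first by rewrite subn0.
have lx : n - x.+1 < n by lia.
have := H _ lx t; have -> : (n - x.+1).+1 = n - x by lia.
by have := IHx (ltnW lxn); lia.
Qed.

Lemma GT_anti P n : GT n P -> forall i t, i <= n -> P i t <= P i 0.
Proof.
case=> H0 H [|i] t lin; first by rewrite !H0.
elim: t => // t; apply: leq_trans.
by have := H i lin t; lia.
Qed.

Lemma GT_support n P : GT n P -> forall i t, i <= n -> i <= t -> P i t = 0.
Proof.
case=> H0 H; elim=> [|i IHi] t lin; first by rewrite H0.
case: t => // t lit; have := H i lin t; have := IHi t (ltnW lin) lit; lia.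
Qed.

(** Surjectivity of RSK: the diagram is filled backwards from the prescribed last column [P] and
    last row [Q]. *)
Lemma growth_of_GT n P Q : GT n P -> GT n Q -> P n =1 Q n ->
  exists A lam, [/\ growth n A lam,
    forall i t, i <= n -> lam i n t = P i t &
    forall j t, j <= n -> lam n j t = Q j t].
Proof.
move=> GP GQ PQ.
(* [g x y] sits at the corner (n - x, n - y), so the top row of [g] is the last row of the
   diagram. *)
pose g := grid (fun _ _ => bwd) (fun y => Q (n - y)) (fun x => P (n - x)).
pose lam i j := g (n - i) (n - j).
pose E (nu mu : nat -> nat) := hstrip mu nu.
have gx0 x t : g x 0 t = P (n - x) t.
  by case: x => [|x]; rewrite /g /= ?subn0 ?PQ.
have [E1 E2] : (forall x y, x < n -> y <= n -> E (g x y) (g x.+1 y)) /\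
    (forall x y, x <= n -> y < n -> E (g x y) (g x y.+1)).
  apply: grid_edges => [y lyn t|x lxn t|x y lxn lyn F1 F2].
  - rewrite /=; have ly : n - y.+1 < n by lia.
    by have := GQ.2 _ ly t; have -> : (n - y.+1).+1 = n - y by lia.
  - rewrite !gx0; have lx : n - x.+1 < n by lia.
    by have := GP.2 _ lx t; have -> : (n - x.+1).+1 = n - x by lia.
  exact: local_rule_hstrip_down (local_rule_bwd F1 F2) F1 F2.
have HP i t : i <= n -> lam i n t = P i t.
  by move=> lin; rewrite /lam subnn gx0 subKn.
have HQ j t : j <= n -> lam n j t = Q j t.
  by move=> ljn; rewrite /lam subnn /g /= subKn.
have S1 i j : i < n -> j <= n -> hstrip (lam i j) (lam i.+1 j).
  move=> lin ljn; rewrite /lam; have -> : n - i = (n - i.+1).+1 by lia.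
  by apply: E1; lia.
have S2 i j : i <= n -> j < n -> hstrip (lam i j) (lam i j.+1).
  move=> lin ljn; rewrite /lam; have -> : n - j = (n - j.+1).+1 by lia.
  by apply: E2; lia.
exists (fun i j => lam i.+1 j.+1 0 - maxn (lam i j.+1 0) (lam i.+1 j 0)), lam.
split=> //; split=> [j t ljn|i t lin|i j lin ljn].
(* Along row 0 the partitions increase up to [lam 0 n], which is [P 0] and hence empty; column 0 is
   treated alike. *)
- have Z x : x <= n -> lam 0 (n - x) t = 0.
    elim: x => [|x IHx] lxn; first by rewrite subn0 HP // GP.1.
    have lx : n - x.+1 < n by lia.
    have := S2 0 _ (leq0n n) lx t; have -> : (n - x.+1).+1 = n - x by lia.
    by have := IHx (ltnW lxn); lia.
  by rewrite -(subKn ljn) Z // leq_subr.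
- have Z x : x <= n -> lam (n - x) 0 t = 0.
    elim: x => [|x IHx] lxn; first by rewrite subn0 HQ // GQ.1.
    have lx : n - x.+1 < n by lia.
    have := S1 _ 0 lx (leq0n n) t; have -> : (n - x.+1).+1 = n - x by lia.
    by have := IHx (ltnW lxn); lia.
  by rewrite -(subKn lin) Z // leq_subr.
have -> : lam i j = bwd (lam i.+1 j.+1) (lam i.+1 j) (lam i j.+1).
  rewrite /lam; have -> : n - i = (n - i.+1).+1 by lia.
  by have -> : n - j = (n - j.+1).+1 by lia.
have := local_rule_bwd (S1 i j.+1 lin ljn) (S2 i.+1 j lin ljn).
rewrite /bwd => -[Ha Hr]; split=> // t.
by have := Hr t; rewrite /= [maxn (lam i.+1 j _) _]maxnC [minn (lam i.+1 j _) _]minnC.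
Qed.

(** After summation over t, max and min combine to [nu1 t + nu2 t]; the shift of index between them
    costs nothing because the m-th parts vanish. *)
Lemma local_rule_sum m a mu nu1 nu2 lam :
  local_rule a mu nu1 nu2 lam -> nu1 m = 0 -> mu m = 0 ->
  \sum_(t < m.+1) lam t + \sum_(t < m.+1) mu t =
  a + (\sum_(t < m.+1) nu1 t + \sum_(t < m.+1) nu2 t).
Proof.
move=> [Ha Hr] nu0 mu0.
rewrite big_ord_recl Ha [X in _ + X = _]big_ord_recr /= mu0 addn0 -addnA.
rewrite -big_split /= (eq_bigr _ (fun (t : 'I_m) _ => Hr t)) big_split /=.
have -> : \sum_(t < m) minn (nu1 t) (nu2 t) = \sum_(t < m.+1) minn (nu1 t) (nu2 t).
  by rewrite big_ord_recr /= nu0 min0n addn0.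
rewrite [maxn _ _ + a]addnC -addnA; congr (_ + _); rewrite addnA.
have <- := big_ord_recl m (fun t : 'I_m.+1 => maxn (nu1 t) (nu2 t)).
rewrite -!big_split /=; apply: eq_bigr => t _; by rewrite addnC addn_min_max.
Qed.

(** The weight of the tableau on the last column is the vector of row sums: the growth in size along
    a vertical edge increases by [A i j] when the cell (i, j) is crossed. *)
Lemma growth_row_sum n A lam : growth n A lam ->
  forall i, i < n ->
  \sum_(t < n) lam i.+1 n t = \sum_(t < n) lam i n t + \sum_(j < n) A i j.
Proof.
move=> G i lin; have [H0 H1 Hl] := G; have [E1 _] := growth_hstrip G.
suff H j : j <= n -> \sum_(t < n) lam i.+1 j t =
    \sum_(t < n) lam i j t + \sum_(j' < j) A i j' by apply: H.
(* The partitions of row i have at most i parts, and i < n, so their parts of index n - 1 vanish as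
   [local_rule_sum] requires. *)
have Hsup j' t : j' <= n -> i <= t -> lam i j' t = 0.
  move=> lj'; have GTj : GT n (fun i => lam i j').
    by split=> [s|x lx]; [apply: H0|apply: E1].
  exact: (GT_support GTj) (ltnW lin).
elim: j => [|j IHj] ljn.
  by rewrite big_ord0 addn0; apply: eq_bigr => t _; rewrite !H1 // ltnW.
have := IHj (ltnW ljn); have := Hl i j lin ljn; rewrite big_ord_recr /=.
case: n lin ljn {G H0 H1 Hl IHj E1} Hsup => // m lin ljn Hsup Hij.
have := local_rule_sum Hij (Hsup j.+1 m ljn lin) (Hsup j m (ltnW ljn) lin).
by move: (\sum_(t < m.+1) _) (\sum_(t < m.+1) _) (\sum_(t < m.+1) _)
  (\sum_(t < m.+1) _) (\sum_(t < j) _) => *; lia.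
Qed.

(** * Complementation *)

(* The i-th partitions are complementary in the rectangle with i rows of
   length [K], one of them rotated by a half-turn. *)
Definition complementary (n K : nat) (P P' : nat -> nat -> nat) : Prop :=
  forall i t, i <= n -> t < i -> P i t + P' i (i - t.+1) = K.

Lemma complementary_uniq n K P1 P2 P' :
  GT n P1 -> GT n P2 -> complementary n K P1 P' -> complementary n K P2 P' ->
  forall i t, i <= n -> P1 i t = P2 i t.
Proof.
move=> G1 G2 C1 C2 i t lin; case: (ltnP t i) => [lti|lit].
  by have := C1 i t lin lti; have := C2 i t lin lti; lia.
by rewrite (GT_support G1 lin lit) (GT_support G2 lin lit).
Qed.

Definition complement (K : nat) (P : nat -> nat -> nat) (i t : nat) : nat :=
  if t < i then K - P i (i - t.+1) else 0.

Lemma complementP n K P :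
  GT n P -> P n 0 <= K -> complementary n K P (complement K P).
Proof.
move=> G leK i t lin lti; rewrite /complement; have -> : i - t.+1 < i by lia.
have -> : i - (i - t.+1).+1 = t by lia.
rewrite subnKC //; apply: leq_trans leK.
exact: leq_trans (GT_anti G t lin) (GT_mono G 0 lin).
Qed.

(** The half-turn exchanges the two interlacing inequalities. *)
Lemma complement_GT n K P : GT n P -> P n 0 <= K -> GT n (complement K P).
Proof.
move=> G leK; split=> // i lin t; rewrite /complement ltnS.
have bnd s : P i.+1 s <= K.
  apply: leq_trans leK.
  exact: leq_trans (GT_anti G s lin) (GT_mono G 0 lin).
case: (ltnP t i) => [lti|lit]; last by rewrite [t.+1 < _]ltnNge ltnS lit.
rewrite [t.+1 < _]ltnS lti (ltnW lti) !subSS; have := G.2 i lin (i - t.+1).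
have -> : (i - t.+1).+1 = i - t by lia.
by have := bnd (i - t); have := bnd (i - t.+1); lia.
Qed.

Lemma complementary_sum n K P P' : GT n P -> GT n P' -> complementary n K P P' ->
  forall i, i <= n -> \sum_(t < n) P i t + \sum_(t < n) P' i t = i * K.
Proof.
move=> G G' C i lin.
have trunc R : GT n R -> \sum_(t < n) R i t = \sum_(t < i) R i t.
  move=> GR; rewrite (big_ord_widen n (R i) lin) [RHS]big_mkcond /=.
  by apply: eq_bigr => t _; case: ltnP => // lit; apply: GT_support GR _ _ lin lit.
rewrite !trunc // [X in _ + X](reindex_inj rev_ord_inj) -big_split /=.
rewrite (eq_bigr (fun=> K)) => [|t _]; last exact: C.
by rewrite sum_nat_const card_ord.
Qed.

Definition bistochastic (n b : nat) (A : nat -> nat -> nat) : Prop :=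
  (forall i, i < n -> \sum_(j < n) A i j = b) /\
  (forall j, j < n -> \sum_(i < n) A i j = b).

(** The last column and the last row are the two tableaux of RSK; both are complemented. *)
Definition complementary_growths (n K : nat)
    (lam lam' : nat -> nat -> nat -> nat) : Prop :=
  complementary n K (fun i => lam i n) (fun i => lam' i n) /\
  complementary n K (fun j => lam n j) (fun j => lam' n j).

(** The sizes of the i-th partitions add up to i * K, so the weights, being successive differences,
    add up to K. *)
Lemma complementary_row_sum n K b b' A A' lam lam' : b + b' = K ->
  growth n A lam -> growth n A' lam' ->
  complementary n K (fun i => lam i n) (fun i => lam' i n) ->
  (forall i, i < n -> \sum_(j < n) A i j = b) ->
  forall i, i < n -> \sum_(j < n) A' i j = b'.
Proof.
move=> Kbb' G G' C HA i lin.
have := growth_row_sum G lin; have := growth_row_sum G' lin; rewrite HA //.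
have := complementary_sum (growth_GT G) (growth_GT G') C lin.
have := complementary_sum (growth_GT G) (growth_GT G') C (ltnW lin).
by rewrite mulSn; lia.
Qed.

Lemma complementary_growth_exists n K b b' A lam : b + b' = K ->
  growth n A lam -> bistochastic n b A -> lam n n 0 <= K ->
  exists A' lam', [/\ growth n A' lam', bistochastic n b' A', lam' n n 0 <= K &
    complementary_growths n K lam lam'].
Proof.
move=> Kbb' G [HR HC] leK; have Gt := growth_trans G.
have GP := growth_GT G; have GQ := growth_GT Gt.
(* Both complements have the same last partition, as both are computed there from [lam n n]. *)
have [A' [lam' [G' HP HQ]]] := growth_of_GT (complement_GT GP leK)
  (complement_GT GQ leK) (fun t => erefl).
have C1 : complementary n K (fun i => lam i n) (fun i => lam' i n).
  by move=> i t lin lti; rewrite HP //; exact: (complementP GP leK).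
have C2 : complementary n K (fun j => lam n j) (fun j => lam' n j).
  by move=> j t ljn ltj; rewrite HQ //; exact: (complementP GQ leK).
exists A', lam'; split=> //; last first.
  by rewrite HP // /complement; case: ifP => // _; apply: leq_subr.
split; first exact: (complementary_row_sum Kbb' G G' C1).
exact: (complementary_row_sum Kbb' Gt (growth_trans G') C2).
Qed.

(** The common matrix [A'] forces the two primed diagrams to agree; so do their complements on the
    final boundary, which determines the matrix. *)
Lemma complementary_growth_inj n K A1 A2 A' lam1 lam2 lam1' lam2' :
  growth n A1 lam1 -> growth n A2 lam2 ->
  growth n A' lam1' -> growth n A' lam2' ->
  complementary_growths n K lam1 lam1' ->
  complementary_growths n K lam2 lam2' ->
  forall i j, i < n -> j < n -> A1 i j = A2 i j.
Proof.
move=> G1 G2 G1' G2' [P1 Q1] [P2 Q2].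
have E := growth_uniq G1' G2'.
apply: (growth_uniq_matrix G1 G2).
  apply: (complementary_uniq (growth_GT G1) (growth_GT G2) P1).
  by move=> i t lin lti; rewrite E //; apply: P2.
apply: (complementary_uniq (growth_GT (growth_trans G1))
  (growth_GT (growth_trans G2)) Q1).
by move=> i t lin lti; rewrite E //; apply: Q2.
Qed.

(** * Words increasing on blocks of positions and of values *)

Definition block_increasing (N b : nat) (w : 'S_N) : bool :=
  [forall p : 'I_N, forall q : 'I_N,
     (p < q) && (p %/ b == q %/ b) ==> (w p < w q)].

Definition chain (N : nat) (w : 'S_N) (S : {set 'I_N}) : bool :=
  [forall p in S, forall q in S, (p < q) ==> (w p < w q)].

Definition bi_increasing (N b : nat) (w : 'S_N) : bool :=
  block_increasing b w && block_increasing b (w^-1)%g.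

Definition cell (N b : nat) (w : 'S_N) (i j : nat) : {set 'I_N} :=
  [set p : 'I_N | (p %/ b == i) && (w p %/ b == j)].

Definition cell_count (N b : nat) (w : 'S_N) (i j : nat) : nat := #|cell b w i j|.

Lemma block_increasingP N b (w : 'S_N) :
  reflect (forall p q : 'I_N, p < q -> p %/ b = q %/ b -> w p < w q)
          (block_increasing b w).
Proof.
apply: (iffP forallP) => [H p q lpq Epq|H p].
  by have /forallP/(_ q)/implyP := H p; apply; rewrite lpq Epq eqxx.
by apply/forallP => q; apply/implyP => /andP[lpq /eqP]; apply: H.
Qed.

Lemma chainP N (w : 'S_N) (S : {set 'I_N}) :
  reflect {in S &, forall p q : 'I_N, p < q -> w p < w q} (chain w S).
Proof.
apply: (iffP forall_inP) => [H p q Sp Sq|H p Sp].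
  by have /forall_inP/(_ q Sq)/implyP := H p Sp.
by apply/forall_inP => q Sq; apply/implyP; apply: H.
Qed.

Lemma bi_increasingP N b (w : 'S_N) : bi_increasing b w ->
  (forall p q : 'I_N, p < q -> p %/ b = q %/ b -> w p < w q) /\
  (forall p q : 'I_N, p < q -> w p %/ b = w q %/ b -> w p < w q).
Proof.
case/andP=> /block_increasingP H1 /block_increasingP H2; split=> // p q lpq E.
have := H2 (w q) (w p); rewrite !permK E.
by case: (ltngtP (w p) (w q)) => // [_ /(_ isT erefl)|/val_inj/perm_inj Epq];
  [lia|move: lpq; rewrite Epq ltnn].
Qed.

Lemma ltn_divW b x y : x %/ b < y %/ b -> x < y.
Proof. by rewrite !ltnNge; apply: contra; apply: leq_div2r. Qed.

(** Together with [chain_exists], this is the first-part case of Greene's theorem: once the points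
    of the cell (i, j) are removed, a chain fits in one of the two smaller rectangles. *)
Lemma chain_bound N b (w : 'S_N) n lam : growth n (cell_count b w) lam ->
  forall i j, i <= n -> j <= n -> forall S : {set 'I_N}, chain w S ->
  (forall p, p \in S -> (p %/ b < i) && (w p %/ b < j)) -> #|S| <= lam i j 0.
Proof.
case=> _ _ Hl; elim=> [|i IHi] j lin.
  move=> _ S _ HS; rewrite (_ : S = set0) ?cards0 //.
  by apply/setP => p; rewrite inE; apply/negP => /HS.
elim: j => [|j IHj] ljn S /chainP cS HS.
  rewrite (_ : S = set0) ?cards0 //.
  by apply/setP => p; rewrite inE; apply/negP => /HS; rewrite andbF.
rewrite (Hl i j lin ljn).1 -(cardsID (cell b w i j) S) addnC.
apply: leq_add; last by apply: subset_leq_card; apply: subsetIr.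
have cD : chain w (S :\: cell b w i j).
  by apply/chainP => p q /setDP[Sp _] /setDP[Sq _]; apply: cS.
rewrite leq_max.
(* If what remains meets block row i at p, then it misses value block j: a point q there would lie
   in an earlier block row, so q < p and w q < w p, although w p lies in a lower value block.
   Otherwise it lies in the rows before i. *)
case: (boolP [exists p in S :\: cell b w i j, p %/ b == i]) => [|/exists_inPn Hno].
  case/exists_inP=> p /setDP[Sp]; rewrite inE => nCp Ep; apply/orP; right.
  rewrite Ep /= in nCp; have := HS p Sp => /andP[_]; rewrite ltnS leq_eqVlt.
  rewrite (negbTE nCp) /= => lpj.
  apply: IHj => //; first exact: ltnW.
  move=> q /setDP[Sq nCq]; have /andP[-> ] := HS q Sq; rewrite ltnS leq_eqVlt /=.
  case/orP=> // Eq; exfalso; rewrite inE Eq andbT in nCq.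
  have /andP[lqi _] := HS q Sq.
  have ltqp : q < p by apply: (@ltn_divW b); move/eqP: Ep => ->; lia.
  have := leq_div2r b (ltnW (cS q p Sq Sp ltqp)); lia.
apply/orP; left; apply: IHi => //; first exact: ltnW.
move=> q qD; have := Hno q qD; move: qD => /setDP[Sq _].
by have /andP[+ ->] := HS q Sq; lia.
Qed.

(** A longest chain of the better of the two smaller rectangles is extended by the whole cell (i,
    j), which is itself a chain since its positions share a block. *)
Lemma chain_exists N b (w : 'S_N) n lam : growth n (cell_count b w) lam ->
  bi_increasing b w -> forall i j, i <= n -> j <= n -> exists S : {set 'I_N},
  [/\ chain w S, #|S| = lam i j 0 &
      forall p, p \in S -> (p %/ b < i) && (w p %/ b < j)].
Proof.
case=> H0 H1 Hl /bi_increasingP[inc1 inc2].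
have empty x : x = 0 -> forall i j, exists S : {set 'I_N},
    [/\ chain w S, #|S| = x &
      forall p, p \in S -> (p %/ b < i) && (w p %/ b < j)].
  move=> -> i j; exists set0; rewrite cards0; split=> // [|p]; last by rewrite inE.
  by apply/chainP => p q; rewrite inE.
have extend i j (S : {set 'I_N}) : chain w S ->
    (forall p q, p \in S -> q \in cell b w i j -> (p < q) && (w p < w q)) ->
    chain w (S :|: cell b w i j) /\
    #|S :|: cell b w i j| = #|S| + cell_count b w i j.
  move=> /chainP cS HS; split.
    apply/chainP => p q /setUP[Sp|Cp] /setUP[Sq|Cq] lpq.
    - exact: cS.
    - by have /andP[] := HS p q Sp Cq.
    - by have /andP[] := HS q p Sq Cp; lia.
    - by apply: inc1 => //; move: Cp Cq; rewrite !inE => /andP[/eqP-> _] /andP[/eqP->].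
  rewrite cardsU (_ : S :&: _ = set0) ?cards0 ?subn0 //.
  apply/setP => p; rewrite !inE; apply/negP => /andP[Sp Cp].
  have := HS p p Sp; rewrite inE Cp => /(_ isT); lia.
elim=> [|i IHi] j lin ljn; first exact/empty/H0.
elim: j ljn => [|j IHj] ljn; first exact/empty/H1.
rewrite (Hl i j lin ljn).1.
(* A chain from either smaller rectangle precedes the cell in position and in value; where it shares
   a block row or a value block with the cell, this comes from [inc1] or [inc2]. *)
have [S [cS eS HS Hc]] : exists S : {set 'I_N}, [/\ chain w S,
    #|S| = maxn (lam i j.+1 0) (lam i.+1 j 0),
    (forall p, p \in S -> (p %/ b <= i) && (w p %/ b <= j)) &
    (forall p q, p \in S -> q \in cell b w i j -> (p < q) && (w p < w q))].
  case: (leqP (lam i j.+1 0) (lam i.+1 j 0)) => _.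
    have [S [cS eS HS]] := IHj (ltnW ljn); exists S; split=> //.
      by move=> p /HS; lia.
    move=> p q /HS; rewrite inE => /andP[lpi lpj] /andP[/eqP Eq /eqP Ewq].
    have lw : w p < w q by apply: (@ltn_divW b); rewrite Ewq.
    rewrite lw andbT ltnNge leq_eqVlt; apply/norP; split.
      by apply: contraTneq lw => /val_inj->; rewrite ltnn.
    apply/negP => lqp; have Eqp : q %/ b = p %/ b.
      by have := leq_div2r b (ltnW lqp); lia.
    by have := inc1 q p lqp Eqp; lia.
  have [S [cS eS HS]] := IHi j.+1 (ltnW lin) ljn; exists S; split=> //.
    by move=> p /HS; lia.
  move=> p q /HS; rewrite inE => /andP[lpi lpj] /andP[/eqP Eq /eqP Ewq].
  have lpq : p < q by apply: (@ltn_divW b); rewrite Eq.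
  rewrite lpq /=; rewrite ltnS leq_eqVlt -Ewq in lpj.
  by case/orP: lpj => [/eqP|]; [apply: inc2|apply: ltn_divW].
have [cU eU] := extend i j S cS Hc.
exists (S :|: cell b w i j); split=> //; first by rewrite eU eS.
by move=> p /setUP[/HS|]; rewrite ?inE; lia.
Qed.

Lemma card_ord_ltn N m : m <= N -> #|[set p : 'I_N | p < m]| = m.
Proof.
move=> lemN; rewrite -sum1dep_card -(big_ord_widen N (fun=> 1)) //.
by rewrite sum1_card card_ord.
Qed.

Lemma card_ord_itv N m1 m2 : m1 <= m2 -> m2 <= N ->
  #|[set p : 'I_N | m1 <= p < m2]| = m2 - m1.
Proof.
move=> le12 le2N.
have -> : [set p : 'I_N | m1 <= p < m2] =
    [set p : 'I_N | p < m2] :\: [set p : 'I_N | p < m1].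
  by apply/setP => p; rewrite !inE -leqNgt.
rewrite cardsDS ?card_ord_ltn // ?(leq_trans le12) //.
by apply/subsetP => p; rewrite !inE => lp; apply: leq_trans lp le12.
Qed.

Lemma card_block n b i : i < n ->
  #|[set p : 'I_(n * b) | p %/ b == i]| = b.
Proof.
move=> lin; case: b => [|b]; first by apply: eq_card0 => -[p lp]; exfalso; lia.
have -> : [set p : 'I_(n * b.+1) | p %/ b.+1 == i] =
    [set p : 'I_(n * b.+1) | i * b.+1 <= p < i.+1 * b.+1].
  by apply/setP => p; rewrite !inE eqn_leq -ltnS ltn_divLR // leq_divRL // andbC.
by rewrite card_ord_itv ?leq_mul2r ?lin ?leqnSn ?orbT // mulSn addnK.
Qed.

Lemma cell_count_inv N b (w : 'S_N) i j :
  cell_count b (w^-1)%g i j = cell_count b w j i.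
Proof.
rewrite /cell_count -[in RHS](card_imset _ (@perm_inj _ w)); congr #|pred_of_set _|.
apply/setP => p; rewrite inE; apply/idP/imsetP => [H|[q + ->]].
  by exists ((w^-1)%g p); rewrite ?permKV // inE permKV andbC.
by rewrite inE permK andbC.
Qed.

Lemma cell_count_row n b (w : 'S_(n * b)) i : 0 < b -> i < n ->
  \sum_(j < n) cell_count b w i j = b.
Proof.
move=> b_gt0 lin; rewrite -[RHS](card_block b lin) -sum1dep_card.
have lt_val (p : 'I_(n * b)) : w p %/ b < n by rewrite ltn_divLR.
pose f p : 'I_n := Ordinal (lt_val p).
rewrite (partition_big f xpredT) //=; apply: eq_bigr => j _.
by rewrite /cell_count -sum1dep_card.
Qed.

Lemma cell_count_bistochastic n b (w : 'S_(n * b)) : 0 < b ->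
  bistochastic n b (cell_count b w).
Proof.
move=> b_gt0; split=> [i lin|j ljn]; first exact: cell_count_row.
rewrite -[RHS](cell_count_row (w^-1)%g b_gt0 ljn).
by apply: eq_bigr => i _; rewrite cell_count_inv.
Qed.

(** Within one value block, values are ordered as positions. Hence [w] is determined by the value
    blocks of its positions. *)
Lemma bi_increasing_card N b (w : 'S_N) p : bi_increasing b w ->
  w p = #|[set q : 'I_N | (w q %/ b < w p %/ b) ||
                          ((w q %/ b == w p %/ b) && (q < p))]| :> nat.
Proof.
case/bi_increasingP=> _ inc2.
rewrite -[LHS](card_ord_ltn (ltnW (ltn_ord (w p)))).
rewrite -(card_preimset _ (@perm_inj _ w)); apply: eq_card => q; rewrite !inE.
case: (ltngtP (w q %/ b) (w p %/ b)) => [|/ltn_divW|E] /=; [exact: ltn_divW|lia|].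
case: (ltngtP q p) => [lqp|lpq|/val_inj->]; last by rewrite ltnn.
  by rewrite inc2.
by have := inc2 p q lpq (esym E); lia.
Qed.

Lemma bi_increasing_inj N b n (w w' : 'S_N) : 0 < b -> N = n * b ->
  bi_increasing b w -> bi_increasing b w' ->
  (forall i j, i < n -> j < n -> cell_count b w i j = cell_count b w' i j) ->
  w = w'.
Proof.
move=> b_gt0 EN inc inc' Ecell.
have blk (p : 'I_N) : p %/ b < n by rewrite ltn_divLR // -EN.
suff Eblk m : forall p : 'I_N, p < m -> w p %/ b = w' p %/ b.
  apply/permP => p; apply: val_inj; rewrite /= (bi_increasing_card p inc).
  rewrite (bi_increasing_card p inc'); apply: eq_card => q; rewrite !inE.
  by rewrite !(Eblk N).
(* Suppose p is the first disagreement and [v p] lies in the lower block. From p on within its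
   block, [v'] stays above the value block of [v p], so the cell of [v'] there is contained in that
   of [v] and lacks p; the counts would differ. *)
have noless (v v' : 'S_N) (p : 'I_N) :
    bi_increasing b v' ->
    (forall q : 'I_N, q < p -> v q %/ b = v' q %/ b) ->
    cell_count b v (p %/ b) (v p %/ b) = cell_count b v' (p %/ b) (v p %/ b) ->
    ~~ (v p %/ b < v' p %/ b).
  case/bi_increasingP=> inc1 _ IH Ec; apply/negP => lt_blk.
  suff /proper_card : cell b v' (p %/ b) (v p %/ b) \proper
      cell b v (p %/ b) (v p %/ b).
    by rewrite /cell_count in Ec; rewrite Ec ltnn.
  apply/properP; split.
    apply/subsetP => q; rewrite !inE => /andP[Eqp /eqP Eq]; rewrite Eqp /=.
    case: (ltngtP q p) => [/IH->|lpq|/val_inj Epq]; first by rewrite Eq.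
      have lv := inc1 p q lpq (esym (eqP Eqp)).
      by have := leq_div2r b (ltnW lv); lia.
    by move: lt_blk; rewrite -{2}Epq Eq ltnn.
  by exists p; rewrite !inE ?eqxx //=; lia.
elim: m => // m IHm p; rewrite ltnS leq_eqVlt => /orP[/eqP Ep|/IHm //].
have IHp (q : 'I_N) : q < p -> w q %/ b = w' q %/ b by rewrite Ep; apply: IHm.
have l1 := noless w w' p inc' IHp (Ecell _ _ (blk p) (blk (w p))).
have IHp' q lqp := esym (IHp q lqp).
have l2 := noless w' w p inc IHp' (esym (Ecell _ _ (blk p) (blk (w' p)))).
lia.
Qed.

(** * The word of a matrix *)

Definition rank (T : finType) (key : T -> nat) (x : T) : nat :=
  #|[set y | key y < key x]|.

Lemma rank_mono (T : finType) (key : T -> nat) x y :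
  key x < key y -> rank key x < rank key y.
Proof.
move=> lxy; apply: proper_card; apply/properP; split.
  by apply/subsetP => z; rewrite !inE => lz; apply: ltn_trans lz lxy.
by exists x; rewrite !inE ?ltnn.
Qed.

Lemma rank_inj (T : finType) (key : T -> nat) : injective key -> injective (rank key).
Proof.
move=> inj x y E; apply: inj; case: (ltngtP (key x) (key y)) => // /rank_mono;
by rewrite E ltnn.
Qed.

Lemma rank_ltn (T : finType) (key : T -> nat) x y :
  injective key -> rank key x < rank key y -> key x < key y.
Proof.
move=> inj; case: (ltngtP (key x) (key y)) => // [/rank_mono|/inj->]; last first.
  by rewrite ltnn.
by move=> l1 l2; have := ltn_trans l1 l2; rewrite ltnn.
Qed.

Lemma rank_bound (T : finType) (key : T -> nat) x : rank key x < #|T|.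
Proof.
rewrite -cardsT; apply: proper_card; apply/properP; split; first exact: subsetT.
by exists x; rewrite !inE ?ltnn.
Qed.

Lemma card_fibers (T : finType) n b (blk : T -> 'I_n) :
  (forall i, #|[set x | blk x == i]| = b) ->
  forall a, a <= n -> #|[set x | blk x < a]| = a * b.
Proof.
move=> fib; elim=> [|a IHa] lan; first by apply: eq_card0 => x; rewrite !inE.
have -> : [set x | blk x < a.+1] =
    [set x | blk x == Ordinal lan] :|: [set x | blk x < a].
  by apply/setP => x; rewrite !inE -val_eqE /= ltnS leq_eqVlt.
rewrite cardsU fib (IHa (ltnW lan)) (_ : _ :&: _ = set0) ?cards0 ?subn0 //.
by apply/setP => x; rewrite !inE -val_eqE /=; case: ltngtP.
Qed.

(** The blocks before that of x contain [blk x * b] elements, all with smaller keys, and the block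
    of x adds only b more. *)
Lemma rank_div (T : finType) n b (key : T -> nat) (blk : T -> 'I_n) :
  (forall i, #|[set x | blk x == i]| = b) ->
  (forall x y, blk x < blk y -> key x < key y) ->
  forall x, rank key x %/ b = blk x.
Proof.
move=> fib mono x; have cf := card_fibers fib.
have lo : blk x * b <= rank key x.
  rewrite -cf ?(ltnW (ltn_ord _)) //; apply: subset_leq_card.
  by apply/subsetP => y; rewrite !inE; apply: mono.
have hi : rank key x < (blk x).+1 * b.
  rewrite -cf //; apply: proper_card; apply/properP; split.
    apply/subsetP => y; rewrite !inE ltnS; apply: contraTT; rewrite -!ltnNge.
    by move/mono => /ltnW; rewrite ltnS.
  by exists x; rewrite !inE ?ltnS ?ltnn.
have b_gt0 : 0 < b by case: (b) hi => //; rewrite muln0.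
by apply/eqP; rewrite eqn_leq -ltnS ltn_divLR // hi leq_divRL.
Qed.

(** A finite set with two linear orders is the graph of a permutation: the rank for [key1] is the
    position and the rank for [key2] the value. *)
Lemma perm_of_keys (T : finType) (key1 key2 : T -> nat) :
  injective key1 -> injective key2 ->
  exists (w : 'S_#|T|) (r : T -> 'I_#|T|), [/\ bijective r,
    forall x, r x = rank key1 x :> nat & forall x, w (r x) = rank key2 x :> nat].
Proof.
move=> inj1 inj2.
pose r1 x := Ordinal (rank_bound key1 x); pose r2 x := Ordinal (rank_bound key2 x).
have r1_inj : injective r1 by move=> x y /(congr1 val)/(rank_inj inj1).
have r2_inj : injective r2 by move=> x y /(congr1 val)/(rank_inj inj2).
have bij1 : bijective r1 by apply: inj_card_bij r1_inj _; rewrite card_ord.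
have [s r1K sK] := bij1.
have w_inj : injective (r2 \o s) by apply: inj_comp => //; apply: can_inj sK.
by exists (perm w_inj), r1; split=> // x; rewrite permE /= r1K.
Qed.

Lemma word_of_cells (T : finType) n b A (blk1 blk2 : T -> 'I_n)
    (key1 key2 : T -> nat) :
  0 < b -> bistochastic n b A ->
  (forall i j : 'I_n, #|[set x | (blk1 x == i) && (blk2 x == j)]| = A i j) ->
  injective key1 -> injective key2 ->
  (forall x y, blk1 x < blk1 y -> key1 x < key1 y) ->
  (forall x y, blk2 x < blk2 y -> key2 x < key2 y) ->
  (forall x y, blk1 x = blk1 y -> key1 x < key1 y -> key2 x < key2 y) ->
  (forall x y, blk2 x = blk2 y -> key2 x < key2 y -> key1 x < key1 y) ->
  exists w : 'S_(n * b), bi_increasing b w /\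
    forall i j, i < n -> j < n -> cell_count b w i j = A i j.
Proof.
move=> b_gt0 [rowA colA] cells inj1 inj2 mono1 mono2 inc1 inc2.
have fib1 i : #|[set x | blk1 x == i]| = b.
  rewrite -(rowA i (ltn_ord i)) -sum1dep_card (partition_big blk2 xpredT) //=.
  by apply: eq_bigr => j _; rewrite -cells -sum1dep_card.
have fib2 j : #|[set x | blk2 x == j]| = b.
  rewrite -(colA j (ltn_ord j)) -sum1dep_card (partition_big blk1 xpredT) //=.
  apply: eq_bigr => i _; rewrite -cells -sum1dep_card.
  by apply: eq_bigl => x; rewrite andbC.
have cardT : #|T| = n * b.
  by rewrite -(card_fibers fib1 (leqnn n)) -cardsT;
    apply: eq_card => x; rewrite !inE ltn_ord.
rewrite -cardT.
have [w [r [[s rK sK] r1 r2]]] := perm_of_keys inj1 inj2.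
have blkr x : r x %/ b = blk1 x by rewrite r1 (rank_div fib1 mono1).
have blkw x : w (r x) %/ b = blk2 x by rewrite r2 (rank_div fib2 mono2).
exists w; split.
  apply/andP; split; apply/block_increasingP => p q.
    rewrite -(sK p) -(sK q) !blkr !r1 !r2 => /(rank_ltn inj1) lk /val_inj E.
    exact/rank_mono/inc1.
  rewrite -(permKV w p) -(permKV w q) -(sK (_ p)) -(sK (_ q)) !permK !blkw !r1 !r2.
  by move=> /(rank_ltn inj2) lk /val_inj E; exact/rank_mono/inc2.
move=> i j lin ljn; rewrite -(cells (Ordinal lin) (Ordinal ljn)) /cell_count.
rewrite -(card_imset _ (can_inj rK)); congr #|pred_of_set _|; apply/setP => p.
rewrite inE -(sK p) blkr blkw mem_imset ?inE //; exact: can_inj rK.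
Qed.

Lemma ltn_lex2 m a a' c c' : c < m -> c' < m ->
  (a * m + c < a' * m + c') = (a < a') || ((a == a') && (c < c')).
Proof.
move=> lc lc'; case: (ltngtP a a') => [laa|laa|->] /=; last by rewrite ltn_add2l.
  by have := leq_mul laa (leqnn m); rewrite mulSn; lia.
by have := leq_mul laa (leqnn m); rewrite mulSn; lia.
Qed.

Lemma ltn_lex3 n b a a' c c' d d' : c < n -> c' < n -> d < b -> d' < b ->
  ((a * n + c) * b + d < (a' * n + c') * b + d') =
  (a < a') || ((a == a') && ((c < c') || ((c == c') && (d < d')))).
Proof.
move=> lc lc' ld ld'; rewrite ltn_lex2 // [_ * n + _ == _]eqn_leq [a * n + c <= _]leqNgt
  [a' * n + c' <= _]leqNgt !ltn_lex2 //.
by case: (ltngtP a a'); case: (ltngtP c c').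
Qed.

Lemma word_of_matrix n b A : 0 < b -> bistochastic n b A ->
  exists w : 'S_(n * b), bi_increasing b w /\
    forall i j, i < n -> j < n -> cell_count b w i j = A i j.
Proof.
move=> b_gt0 HA.
(* Entries are at most b, so the copies of a point within a cell can be numbered by ['I_b]. *)
have leA (i j : 'I_n) : A i j <= b.
  by rewrite -(HA.1 i (ltn_ord i)) (bigD1 j) //= leq_addr.
pose U : finType := ('I_n * 'I_n * 'I_b)%type.
pose inA (x : U) := x.2 < A x.1.1 x.1.2.
pose T : finType := {x : U | inA x}.
pose blk1 (x : T) := (val x).1.1; pose blk2 (x : T) := (val x).1.2.
(* The points form the two-line array of RSK: [key1] sorts them lexicographically by row, column and
   copy number, [key2] by column, row and copy number. *)
pose key1 (x : T) := (blk1 x * n + blk2 x) * b + (val x).2.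
pose key2 (x : T) := (blk2 x * n + blk1 x) * b + (val x).2.
have key1E x y : (key1 x < key1 y) = (blk1 x < blk1 y) || ((blk1 x == blk1 y) &&
    ((blk2 x < blk2 y) || ((blk2 x == blk2 y) && ((val x).2 < (val y).2)))).
  exact: ltn_lex3.
have key2E x y : (key2 x < key2 y) = (blk2 x < blk2 y) || ((blk2 x == blk2 y) &&
    ((blk1 x < blk1 y) || ((blk1 x == blk1 y) && ((val x).2 < (val y).2)))).
  exact: ltn_lex3.
have eqT (x y : T) : blk1 x = blk1 y -> blk2 x = blk2 y ->
    (val x).2 = (val y).2 :> nat -> x = y.
  move=> E1 E2 /val_inj E3; apply: val_inj; move: E1 E2 E3; rewrite /blk1 /blk2.
  by case: (val x) (val y) => [[? ?] ?] [[? ?] ?] /= -> -> ->.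
have inj1 : injective key1.
  move=> x y E; have := key1E x y; have := key1E y x; rewrite E ltnn.
  case: (ltngtP (blk1 x) (blk1 y)) => //= /val_inj E1; rewrite E1 eqxx /=.
  case: (ltngtP (blk2 x) (blk2 y)) => //= /val_inj E2; rewrite E2 eqxx /=.
  by case: (ltngtP (val x).2 (val y).2) => // E3 _ _; apply: eqT.
have inj2 : injective key2.
  move=> x y E; have := key2E x y; have := key2E y x; rewrite E ltnn.
  case: (ltngtP (blk2 x) (blk2 y)) => //= /val_inj E2; rewrite E2 eqxx /=.
  case: (ltngtP (blk1 x) (blk1 y)) => //= /val_inj E1; rewrite E1 eqxx /=.
  by case: (ltngtP (val x).2 (val y).2) => // E3 _ _; apply: eqT.
have cells (i j : 'I_n) : #|[set x | (blk1 x == i) && (blk2 x == j)]| = A i j.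
  rewrite -[RHS](card_ord_ltn (leA i j)) -(card_imset _ val_inj).
  have pair_inj : injective (fun c : 'I_b => (i, j, c) : U) by move=> c c' [].
  rewrite -[RHS](card_imset _ pair_inj); congr #|pred_of_set _|.
  apply/setP => x; apply/imsetP/imsetP => [[y + ->]|[c + ->]]; rewrite inE.
    move: (valP y); rewrite /blk1 /blk2 /inA.
    by case: (val y) => [[i' j'] c] /= lc /andP[/eqP Ei /eqP Ej];
      exists c; rewrite ?inE -?Ei -?Ej.
  by move=> lc; exists (Sub (i, j, c) lc : T); rewrite ?inE /blk1 /blk2 SubK //= !eqxx.
apply: (word_of_cells b_gt0 HA cells inj1 inj2) => x y.
- by rewrite key1E => ->.
- by rewrite key2E => ->.
- by move=> E; rewrite key1E key2E E ltnn eqxx /= => /orP[->|/andP[/eqP-> ->]] //;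
    rewrite eqxx orbT.
- by move=> E; rewrite key1E key2E E ltnn eqxx /= => /orP[->|/andP[/eqP-> ->]] //;
    rewrite eqxx orbT.
Qed.

(** * Enumeration *)

Definition bi_words (N b K : nat) : {set 'S_N} :=
  [set w : 'S_N | bi_increasing b w &&
     [forall S : {set 'I_N}, chain w S ==> (#|S| <= K)]].

Lemma growth_ext n A A' lam : growth n A lam ->
  (forall i j, i < n -> j < n -> A' i j = A i j) -> growth n A' lam.
Proof. by case=> H0 H1 Hl E; split=> // i j lin ljn; rewrite E //; apply: Hl. Qed.

Lemma bi_words_growth n b K (w : 'S_(n * b)) lam : 0 < b ->
  growth n (cell_count b w) lam -> bi_increasing b w ->
  (w \in bi_words (n * b) b K) = (lam n n 0 <= K).
Proof.
move=> b_gt0 G inc; rewrite inE inc /=.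
apply/forallP/idP => [H|le S].
  have [S [cS <- _]] := chain_exists G inc (leqnn n) (leqnn n).
  exact: implyP (H S) cS.
apply/implyP => cS; apply: leq_trans le; apply: (chain_bound G) cS _ => // p _.
by rewrite !ltn_divLR // !ltn_ord.
Qed.

(** Complementation of words is known only through existence statements, so it enters as a relation,
    from which a function is chosen; [u0] is its value outside [X]. *)
Lemma leq_card_rel (T U : finType) (X : {set T}) (Y : {set U})
    (R : T -> U -> Prop) (u0 : U) :
  (forall x, x \in X -> exists2 y, y \in Y & R x y) ->
  (forall x1 x2 y, x1 \in X -> x2 \in X -> R x1 y -> R x2 y -> x1 = x2) ->
  #|X| <= #|Y|.
Proof.
move=> total uniq.
have /fin_all_exists[f Hf] x : exists y, x \in X -> y \in Y /\ R x y.
  case: (boolP (x \in X)) => [/total[y Yy Rxy]|_]; first by exists y.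
  by exists u0.
rewrite -(card_in_imset (f := f) (D := X)).
  by apply: subset_leq_card; apply/subsetP => _ /imsetP[x Xx ->]; case: (Hf x Xx).
move=> x1 x2 X1 X2 E; have [_ R1] := Hf x1 X1; have [_ R2] := Hf x2 X2.
by apply: uniq X1 X2 R1 _; rewrite E.
Qed.

(** Two words are related when their growth diagrams are complementary. Exchanging [b] and [b']
    gives the opposite inequality. *)
Lemma leq_card_bi_words n b b' : 0 < b -> 0 < b' ->
  #|bi_words (n * b) b (b + b')| <= #|bi_words (n * b') b' (b + b')|.
Proof.
move=> b_gt0 b'_gt0; set K := b + b'.
pose R (w : 'S_(n * b)) (w' : 'S_(n * b')) := exists lam lam',
  [/\ growth n (cell_count b w) lam, growth n (cell_count b' w') lam' &
      complementary_growths n K lam lam'].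
apply: (leq_card_rel (R := R) 1%g) => [w Ww|w1 w2 w' W1 W2].
  have [lam G] := growth_exists n (cell_count b w).
  have inc : bi_increasing b w by move: Ww; rewrite inE => /andP[].
  have leK : lam n n 0 <= K by rewrite -(bi_words_growth K b_gt0 G inc).
  have [A' [lam' [G' HA' leK' C]]] := complementary_growth_exists (erefl K) G
    (cell_count_bistochastic w b_gt0) leK.
  have [w' [inc' Ew']] := word_of_matrix b'_gt0 HA'.
  have Gw' := growth_ext G' Ew'.
  by exists w'; [rewrite (bi_words_growth K b'_gt0 Gw' inc')|exists lam, lam'].
case=> [lam1 [lam1' [G1 G1' C1]]] [lam2 [lam2' [G2 G2' C2]]].
move: W1 W2; rewrite !inE => /andP[inc1 _] /andP[inc2 _].
apply: (bi_increasing_inj b_gt0 (erefl (n * b)) inc1 inc2).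
exact: (complementary_growth_inj G1 G2 G1' G2' C1 C2).
Qed.

Lemma card_bi_words n b b' : 0 < b -> 0 < b' ->
  #|bi_words (n * b) b (b + b')| = #|bi_words (n * b') b' (b + b')|.
Proof.
move=> b_gt0 b'_gt0; apply/eqP; rewrite eqn_leq leq_card_bi_words //=.
by rewrite addnC leq_card_bi_words.
Qed.

(** * Increasing patterns and chains *)

Lemma contains_incr_pattern N m (w : 'S_N) :
  contains w (incr_pattern m) = [exists S : {set 'I_N}, chain w S && (m <= #|S|)].
Proof.
apply/existsP/existsP => [[f /andP[/forallP f_lt /forallP f_pat]]|].
  have lt_f (a c : 'I_m) : a < c -> f a < f c.
    by have /forallP/(_ c)/implyP := f_lt a.
  have f_inj : injective f.
    move=> a c E; apply/val_inj; case: (ltngtP a c) => // /lt_f;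
    by rewrite E ltnn.
  exists [set f a | a : 'I_m]; rewrite card_imset // card_ord leqnn andbT.
  apply/chainP => _ _ /imsetP[a _ ->] /imsetP[c _ ->] lac.
  have /forallP/(_ c)/eqP-> := f_pat a; rewrite !perm1.
  by case: (ltngtP a c) => // [/lt_f|/val_inj E]; [lia|move: lac; rewrite E ltnn].
case=> S /andP[/chainP cS leS].
(* [enum S] lists positions in increasing order, so its first m entries give an occurrence of the
   pattern. *)
have srt : sorted (relpre val ltn) (enum S).
  rewrite /(enum _); apply: sorted_filter; first by move=> x y z; apply: ltn_trans.
  by rewrite -enumT -sorted_map val_enum_ord iota_ltn_sorted.
have sz (a : 'I_m) : a < #|S| by apply: leq_trans leS.
pose f (a : 'I_m) : 'I_N := enum_val (Ordinal (sz a)).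
have f_lt (a c : 'I_m) : a < c -> f a < f c.
  move=> lac; rewrite /f !(enum_val_nth (enum_default (Ordinal (sz a)))).
  apply: (sorted_ltn_nth _ _ srt) => //; rewrite ?inE -?cardE //.
  by move=> x y z; apply: ltn_trans.
have w_lt (a c : 'I_m) : a < c -> w (f a) < w (f c).
  by move=> lac; apply: cS; rewrite ?enum_valP ?f_lt.
exists [ffun a => f a]; apply/andP; split; apply/forallP => a; apply/forallP => c.
  by rewrite !ffunE; apply/implyP/f_lt.
rewrite !ffunE !perm1; apply/eqP.
case: (ltngtP a c) => [/w_lt|/w_lt|/val_inj->] //; last by rewrite ltnn.
by move=> l; apply/negbTE; rewrite -leqNgt ltnW.
Qed.

Lemma avoids_incr_pattern N K (w : 'S_N) :
  ~~ contains w (incr_pattern K.+1) =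
  [forall S : {set 'I_N}, chain w S ==> (#|S| <= K)].
Proof.
rewrite contains_incr_pattern negb_exists; apply: eq_forallb => S.
by rewrite negb_and implybE -leqNgt.
Qed.

Lemma chain_inv N (w : 'S_N) (S : {set 'I_N}) :
  chain w S -> chain (w^-1)%g (w @: S).
Proof.
move=> /chainP cS; apply/chainP => _ _ /imsetP[p Sp ->] /imsetP[q Sq ->].
rewrite !permK; case: (ltngtP p q) => // [lqp|/val_inj->]; last by rewrite ltnn.
by have := cS q p Sq Sp lqp; lia.
Qed.

Lemma avoids_incr_pattern_inv N m (w : 'S_N) :
  contains (w^-1)%g (incr_pattern m) = contains w (incr_pattern m).
Proof.
have imp (v : 'S_N) : contains v (incr_pattern m) ->
    contains (v^-1)%g (incr_pattern m).
  rewrite !contains_incr_pattern => /existsP[S /andP[cS leS]].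
  apply/existsP; exists (v @: S).
  by rewrite chain_inv // card_imset //; apply: perm_inj.
by apply/idP/idP => /imp; rewrite ?invgK.
Qed.

(** * Conditions (L1) and (L2) *)

Lemma Lset_block_increasing n k (w : 'S_(n * k)) :
  w \in Lset n k -> block_increasing k w.
Proof.
rewrite inE => /andP[/forallP L1 _]; apply/block_increasingP => p q lpq E.
have k_gt0 : 0 < k by case: (k) p {lpq E} => // -[p lp]; exfalso; lia.
have lt_blk (x : 'I_(n * k)) : x %/ k < n by rewrite ltn_divLR.
have lt_off (x : 'I_(n * k)) : x %% k < k by rewrite ltn_mod.
(* (L1) compares adjacent entries only; it is iterated along the distance d + 1 between two offsets
   of a block. *)
have incr j (lj : j < k) d (ljd : j + d.+1 < k) (i : 'I_n) :
    w (pos i (Ordinal lj)) < w (pos i (Ordinal ljd)).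
  elim: d ljd => [|d IHd] ljd.
    have /forallP/(_ (Ordinal lj))/forallP/(_ (Ordinal ljd))/implyP := L1 i.
    by apply; rewrite /= addn1.
  have ljd' : j + d.+1 < k by lia.
  apply: ltn_trans (IHd ljd') _.
  have /forallP/(_ (Ordinal ljd'))/forallP/(_ (Ordinal ljd))/implyP := L1 i.
  by apply; rewrite /= addnS.
have lmod : p %% k < q %% k.
  by move: lpq; rewrite {1}(divn_eq p k) {1}(divn_eq q k) E ltn_add2l.
have ld : p %% k + (q %% k - p %% k).-1.+1 < k.
  by have := lt_off q; lia.
have := incr _ (lt_off p) _ ld (Ordinal (lt_blk p)).
set p' := pos _ _; set q' := pos _ _.
have -> : p' = p by apply: val_inj; rewrite /= -divn_eq.
have -> // : q' = q.
apply: val_inj; rewrite /= prednK ?subn_gt0 // subnKC ?(ltnW lmod) //.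
by rewrite E -divn_eq.
Qed.

(* If (L2) failed at (i, j), then w_{i,1} < ... < w_{i,j+1} < w_{i+1,j} < ... <
   w_{i+1,k} would be an increasing subsequence of length k + 2. *)
Lemma block_increasing_Lset n k (w : 'S_(n * k)) : block_increasing k w ->
  ~~ contains w (incr_pattern k.+2) -> w \in Lset n k.
Proof.
move=> /block_increasingP inc; rewrite avoids_incr_pattern => /forallP av.
rewrite inE; apply/andP; split.
  apply/forallP => i; apply/forallP => j; apply/forallP => j'.
  apply/implyP => /eqP Ej; apply: inc; rewrite /= ?Ej; first by lia.
  by rewrite !divnMDl ?divn_small //; have := ltn_ord j'; lia.
apply/forallP => i; apply/forallP => i'; apply/forallP => j; apply/forallP => j'.
apply/implyP => /andP[/eqP Ei /eqP Ej]; rewrite ltnNge; apply/negP => le_w.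
have lt_w : w (pos i j') < w (pos i' j).
  rewrite ltn_neqAle le_w andbT; apply/negP => /eqP/val_inj/perm_inj/(congr1 val) /=.
  rewrite Ei Ej; have := ltn_ord j'; rewrite Ej mulSn; lia.
have wle (p q : 'I_(n * k)) : p <= q -> p %/ k = q %/ k -> w p <= w q.
  rewrite leq_eqVlt => /orP[/eqP/val_inj-> //|lpq E]; exact/ltnW/inc.
have lj := ltn_ord j'; rewrite Ej in lj.
have k_gt0 : 0 < k by lia.
have blk (a : 'I_n) (p : 'I_(n * k)) : a * k <= p -> p < a.+1 * k -> p %/ k = a.
  by move=> l1 l2; apply/eqP; rewrite eqn_leq -ltnS ltn_divLR // l2 leq_divRL.
(* With indices from 0, [S1] has j + 2 positions and [S2] has k - j, which makes k + 2 in all. *)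
pose S1 := [set p : 'I_(n * k) | i * k <= p < i * k + j.+2].
pose S2 := [set p : 'I_(n * k) | i' * k + j <= p < i'.+1 * k].
have lei' : i'.+1 * k <= n * k by rewrite leq_mul2r ltn_ord orbT.
have Ei'k : i' * k = k + i * k by rewrite Ei mulSn.
have Ei'k2 : i'.+1 * k = k + i' * k by rewrite mulSn.
have blk1 p : p \in S1 -> p %/ k = i.
  by rewrite inE => /andP[l1 l2]; apply: blk => //; rewrite mulSn; lia.
have blk2 p : p \in S2 -> p %/ k = i'.
  by rewrite inE => /andP[l1 l2]; apply: blk => //; lia.
have lt12 p q : p \in S1 -> q \in S2 -> w p < w q.
  move=> p1 q2; apply: leq_ltn_trans (_ : w (pos i j') < _).
    apply: wle; first by move: p1; rewrite inE /= Ej; lia.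
    by rewrite (blk1 _ p1) /= divnMDl ?divn_small ?addn0 //; lia.
  apply: leq_trans lt_w _; apply: wle; first by move: q2; rewrite inE /=; lia.
  by rewrite (blk2 _ q2) /= divnMDl ?divn_small ?addn0 //; lia.
have cS : chain w (S1 :|: S2).
  apply/chainP => p q /setUP[p1|p2] /setUP[q1|q2] lpq.
  - by apply: inc; rewrite // !blk1.
  - exact: lt12.
  - by move: p2 q1; rewrite !inE; lia.
  - by apply: inc; rewrite // !blk2.
have := implyP (av _) cS; rewrite cardsU (_ : S1 :&: S2 = set0).
  by rewrite cards0 !card_ord_itv; lia.
by apply/setP => p; rewrite !inE; lia.
Qed.

Lemma avoiders_bi_words n k :
  [set w in avoiders (Lset n k) (incr_pattern k.+2) |
       (w^-1)%g \in avoiders (Lset n k) (incr_pattern k.+2)] =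
  bi_words (n * k) k k.+1.
Proof.
apply/setP => w; rewrite in_set /avoiders in_set [_ \in [set w in Lset n k | _]]in_set.
rewrite avoids_incr_pattern_inv [RHS]in_set -avoids_incr_pattern.
case: (boolP (contains w _)) => [_|av]; first by rewrite !andbF.
have av' : ~~ contains (w^-1)%g (incr_pattern k.+2).
  by rewrite avoids_incr_pattern_inv.
have LE (v : 'S_(n * k)) : ~~ contains v (incr_pattern k.+2) ->
    (v \in Lset n k) = block_increasing k v.
  move=> avv; apply/idP/idP; first exact: Lset_block_increasing.
  by move=> inc; apply: block_increasing_Lset.
by rewrite !andbT !LE.
Qed.

(** Blocks of length 1 impose no condition. The size [m] is kept apart from [n] so that it can be
    taken to be [n * 1]. *)
Lemma avoiders_setT_bi_words n m K :
  m = n -> #|avoiders [set: 'S_n] (incr_pattern K.+1)| = #|bi_words m 1 K|.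
Proof.
move=> ->; apply: eq_card => w; rewrite !inE avoids_incr_pattern /=.
by rewrite (_ : bi_increasing 1 w) //; apply/andP; split;
  apply/block_increasingP => p q lpq; rewrite !divn1 => E; move: lpq; rewrite E ltnn.
Qed.

Lemma in_bijection_of_card (T U : finType) (A : {set T}) (B : {set U}) :
  #|A| = #|B| -> in_bijection A B.
Proof.
move=> eqAB.
have eqc : #|{: {x : T | x \in A}}| = #|{: {y : U | y \in B}}|.
  by rewrite !card_sig.
exists (fun x => enum_val (cast_ord eqc (enum_rank x))).
apply: (inj_card_bij _ _) => [x y /enum_val_inj/cast_ord_inj/enum_rank_inj //|].
by rewrite eqc.
Qed.

Theorem theorem5p2 (n k : nat) (hn : 1 <= n) (hk : 1 <= k) :
  in_bijection
    [set w in avoiders (Lset n k) (incr_pattern k.+2) |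
       (w^-1)%g \in avoiders (Lset n k) (incr_pattern k.+2)]
    (avoiders [set: 'S_n] (incr_pattern k.+2)).
Proof.
apply: in_bijection_of_card.
(* What remains is the symmetry between block lengths [k] and 1, both with chain bound K = k + 1. *)
rewrite avoiders_bi_words (avoiders_setT_bi_words _ (muln1 n)) -addn1.
exact: card_bi_words.
Qed.
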